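(* Let $E$ be a complex inner product space. For all nonzero vectors $x, y \in E$, we have $$(x, y) = \|x\|\|y\|\left(\left(1 - \frac12 \left\|\frac{x}{\|x\|}-\frac{y}{\|y\|}\right\|^2\right) + i \left(1 - \frac12 \left\|\frac{x}{\|x\|}-\frac{i y}{\|y\|}\right\|^2\right)\right),$$ and thus $$|(x, y)| = \|x\|\|y\|\sqrt{\left(1 - \frac12 \left\|\frac{x}{\|x\|}-\frac{y}{\|y\|}\right\|^2\right)^2 + \left(1 - \frac12 \left\|\frac{x}{\|x\|}-\frac{i y}{\|y\|}\right\|^2\right)^2}.$$
   Context: The inner product $(x,y)$ is linear in the first argument and conjugate linear in the second, and $\|x\| = \sqrt{(x,x)}$. *)

(* Defs.v *)
From HB Require Import structures.
From mathcomp Require Import all_boot all_order all_algebra.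
From mathcomp Require Import sesquilinear complex reals.

Set Implicit Arguments.
Unset Strict Implicit.
Unset Printing Implicit Defensive.
Import Order.TTheory GRing.Theory Num.Theory.

Local Open Scope ring_scope.

(* A complex inner product space is an arbitrary module E over the complex
   numbers R[i] with a positive definite hermitian form ip : {dot E for conjC};
   in {dot E for theta} the form is linear in the first argument and
   theta-linear in the second.

   As everywhere over a numClosedFieldType, absolute values and norms are
   elements of R[i] (nonnegative, hence real): sqrtC is the nonnegative square
   root on nonnegative elements, and ip x x is one of these. *)
Definition ip_norm (R : realType) (E : lmodType R[i])
    (ip : {dot E for @Num.conj R[i]}) (x : E) : R[i] :=
  sqrtC (ip x x).

(* Main.v *)
Require Import Defs.
From HB Require Import structures.
From mathcomp Require Import all_boot all_order all_algebra.
From mathcomp Require Import sesquilinear complex reals.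

Set Implicit Arguments.
Unset Strict Implicit.
Unset Printing Implicit Defensive.
Import Order.TTheory GRing.Theory Num.Theory.

Local Open Scope ring_scope.

(** Normalizing both vectors pulls the positive factor [N x * N y] out of [ip x y] and reduces the
    claim to unit vectors. For unit [u], [v], expanding the squared norm of [u - v] gives 2 minus
    twice the real part of [ip u v] ([Re_ip_unit]). Replacing [v] by ['i *: v] turns the real part
    into the imaginary part ([Im_ip_unit]). So [a] and [b] are the real and imaginary parts of one
    complex number, and the modulus formula follows. *)

Section UnitVectors.

Variables (R : realType) (E : lmodType R[i]) (ip : {dot E for @Num.conj R[i]}).
Local Notation N := (ip_norm ip).

Lemma ip_norm_gt0 x : (0 < N x) = (x != 0).
Proof. exact: sqrt_dnorm_gt0. Qed.

Lemma ip_normK x : N x ^+ 2 = ip x x.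
Proof. exact: sqrtCK. Qed.

Lemma ip_normZ a x : N (a *: x) = `|a| * N x.
Proof.
by rewrite /ip_norm dnormZ sqrtCM ?nnegrE ?dnorm_ge0 ?exprn_ge0 // sqrCK.
Qed.

Lemma ip_norm_normalize x : x != 0 -> N ((N x)^-1 *: x) = 1.
Proof.
rewrite -ip_norm_gt0 => x_gt0.
by rewrite ip_normZ ger0_norm ?invr_ge0 ?ltW // mulVf ?gt_eqF.
Qed.

Lemma Re_ip_unit u v : N u = 1 -> N v = 1 ->
  'Re (ip u v) = 1 - 1 / 2 * N (u - v) ^+ 2.
Proof.
move=> Nu Nv; rewrite ip_normK dnormB -!ip_normK Nu Nv expr1n ReE.
by rewrite mul1r mulrBr mulVf ?pnatr_eq0 // subKr mulrC.
Qed.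

(** Conjugate linearity pulls ['i] out of the second argument as [- 'i], and the real part of
    [- 'i * z] is the imaginary part of [z]. *)
Lemma Re_ip_scale_i u v : 'Re (ip u ('i *: v)) = 'Im (ip u v).
Proof. by rewrite linearZr_LR /= conjCi mulNr raddfN /= ReMil opprK. Qed.

Lemma Im_ip_unit u v : N u = 1 -> N v = 1 ->
  'Im (ip u v) = 1 - 1 / 2 * N (u - 'i *: v) ^+ 2.
Proof.
move=> Nu Nv; rewrite -Re_ip_scale_i Re_ip_unit //.
by rewrite ip_normZ normCi mul1r.
Qed.

Lemma ip_normalize x y : x != 0 -> y != 0 ->
  ip x y = N x * N y * ip ((N x)^-1 *: x) ((N y)^-1 *: y).
Proof.
rewrite -!ip_norm_gt0 => x_gt0 y_gt0.
(* The scalar from the second argument comes out conjugated; being a nonnegative real, it is its own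
   conjugate. *)
rewrite linearZr_LR linearZl_LR /= geC0_conj ?invr_ge0 ?ltW //.
by rewrite [RHS]mulrA mulfK ?gt_eqF // mulVKf ?gt_eqF.
Qed.

End UnitVectors.

Theorem corollary2p2 (R : realType) (E : lmodType R[i])
    (ip : {dot E for @Num.conj R[i]}) (x y : E) (hx : x != 0) (hy : y != 0) :
  let N := ip_norm ip in
  let a := 1 - 1 / 2 * N ((N x)^-1 *: x - (N y)^-1 *: y) ^+ 2 in
  let b := 1 - 1 / 2 * N ((N x)^-1 *: x - (N y)^-1 *: ('i *: y)) ^+ 2 in
  ip x y = N x * N y * (a + 'i * b) /\
  `|ip x y| = N x * N y * sqrtC (a ^+ 2 + b ^+ 2).
Proof.
move=> N a b.
have Nu : N ((N x)^-1 *: x) = 1 by exact: ip_norm_normalize.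
have Nv : N ((N y)^-1 *: y) = 1 by exact: ip_norm_normalize.
have -> : a = 'Re (ip ((N x)^-1 *: x) ((N y)^-1 *: y)).
  by rewrite Re_ip_unit.
have -> : b = 'Im (ip ((N x)^-1 *: x) ((N y)^-1 *: y)).
  (* In [b] the factor ['i] sits inside the normalization; the two scalars commute. *)
  by rewrite Im_ip_unit // /b !scalerA [_ * 'i]mulrC.
(* With [z] the inner product of the normalized vectors, [a + 'i * b] folds to [z] and the square
   root to the modulus of [z]. *)
rewrite -Crect -normC2_Re_Im sqrCK //; split; first exact: ip_normalize.
rewrite {1}ip_normalize // normrM (ger0_norm (x := _ * _)) //.
by rewrite mulr_ge0 // ltW // ip_norm_gt0.
Qed.
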